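(* Let $n\ge 0$, let $M,N\in\mathcal{M}(n)$ be two (not necessarily distinct) matchings, let $s,t\in\{cr,ne\}$ and $u,v\in\{cn,nc\}$ (allowing $s=t$ and $u=v$). 1. If $s(\mathcal{T}(M,l))=t(\mathcal{T}(N,l))$ for $l=0,1$, then $s(\mathcal{T}(M,l))=t(\mathcal{T}(N,l))$ for all $l\ge 0$. 2. If $u(\mathcal{T}(M,l))=v(\mathcal{T}(N,l))$ for $l=0,1$, then $u(\mathcal{T}(M,l))=v(\mathcal{T}(N,l))$ for all $l\ge 0$. Here all equalities are equalities of multisets.
   Context: A matching on $[2n]=\{1,\dots,2n\}$ is a partition of $[2n]$ into $n$ two-element blocks (edges); $\mathcal{M}(n)$ is the set of matchings on $[2n]$, with $\mathcal{M}(0)=\{\emptyset\}$. Two distinct edges $A,B$ cross if $\min A<\min B<\max A<\max B$ or vice versa; they are nested if $\min A<\min B<\max B<\max A$ or vice versa. $cr(M)$ and $ne(M)$ are the numbers of crossing pairs and of nested pairs of edges in $M$; $cn(M)=(cr(M),ne(M))\in\mathbb{N}_0^2$ and $nc(M)=(ne(M),cr(M))$. For $M\in\mathcal{M}(n)$, a child of $M$ is any matching in $\mathcal{M}(n+1)$ obtained by choosing $x\in\{2,\dots,2n+2\}$, relabeling the vertices of $M$ order-preservingly by $\{2,\dots,2n+2\}\setminus\{x\}$, and adding the edge $\{1,x\}$. $\mathcal{T}(M,0)=\{M\}$ and $\mathcal{T}(M,l+1)$ is the set of all children of members of $\mathcal{T}(M,l)$ (equivalently, the matchings in $\mathcal{M}(n+l)$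 whose last $n$ edges, edges ordered by their smaller elements, form a matching order-isomorphic to $M$). For a statistic $f$ and a set $Z$ of matchings, $f(Z)$ is the multiset of values $f(z)$, $z\in Z$, with multiplicities. *)

(* Defs.v *)
From mathcomp Require Import all_boot.

Set Implicit Arguments.
Unset Strict Implicit.
Unset Printing Implicit Defensive.

(* The vertex set [2n] is 'I_n.*2: the vertex k of the paper is k - 1 here.   *)
Definition matchings (n : nat) : {set {set {set 'I_n.*2}}} :=
  [set M | partition M [set: 'I_n.*2] & [forall A in M, #|A| == 2]].

(* The default value m of emin is irrelevant on nonempty sets.                *)
Definition emin (m : nat) (A : {set 'I_m}) : nat :=
  \big[minn/m]_(i in A) (i : nat).

Definition emax (m : nat) (A : {set 'I_m}) : nat := \max_(i in A) (i : nat).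

Definition crossing (m : nat) : rel {set 'I_m} := fun A B =>
  (emin A < emin B < emax A) && (emax A < emax B) ||
  (emin B < emin A < emax B) && (emax B < emax A).

Definition nested (m : nat) : rel {set 'I_m} := fun A B =>
  (emin A < emin B < emax B) && (emax B < emax A) ||
  (emin B < emin A < emax A) && (emax A < emax B).

(* The pairs are unordered; crossing and nested are irreflexive, so A and B   *)
(* are automatically distinct.                                                *)
Definition cr (m : nat) (M : {set {set 'I_m}}) : nat :=
  #|[set [set A; B] | A in M, B in M & crossing A B]|.

Definition ne (m : nat) (M : {set {set 'I_m}}) : nat :=
  #|[set [set A; B] | A in M, B in M & nested A B]|.

Definition cn (m : nat) (M : {set {set 'I_m}}) : nat * nat := (cr M, ne M).

Definition nc (m : nat) (M : {set {set 'I_m}}) : nat * nat := (ne M, cr M).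

(* The new edge is {1, x} with x = y + 2, 0 <= y <= 2n; i |-> lift y i is the *)
(* increasing bijection from 'I_n.*2 onto the complement of y in 'I_n.*2.+1,  *)
(* and lift ord0 shifts by one to make room for the new first vertex.         *)
Definition child (n : nat) (M : {set {set 'I_n.*2}}) (y : 'I_n.*2.+1) :
    {set {set 'I_n.+1.*2}} :=
  [set (ord0 : 'I_n.*2.+2); lift ord0 y]
    |: [set [set lift ord0 (lift y i) | i in A] | A : {set 'I_n.*2} in M].

Definition children (n : nat) (M : {set {set 'I_n.*2}}) :
    {set {set {set 'I_n.+1.*2}}} :=
  [set child M y | y : 'I_n.*2.+1].

Fixpoint T (n : nat) (M : {set {set 'I_n.*2}}) (l : nat) :
    {set {set {set 'I_(l + n).*2}}} :=
  match l with
  | 0 => [set M]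
  | l'.+1 => \bigcup_(P in T M l') children P
  end.

(* The multiset f(Z), as a sequence to be compared up to perm_eq.             *)
Definition values (m : nat) (X : Type) (f : {set {set 'I_m}} -> X)
    (Z : {set {set {set 'I_m}}}) : seq X :=
  [seq f z | z in Z].

(* Main.v *)
Require Import Defs.
From mathcomp Require Import all_boot all_algebra.
From mathcomp Require Import zify ring.

(* Give the gap g of a matching M (a place where the second end of a new first
   edge may go) the weight x_g = p^c r^d, where c edges of M cover g and d edges
   end before g.  Inserting the edge at g multiplies p^cr r^ne by x_g and turns
   the gap weights x_0, ..., x_m into 1, p x_0, ..., p x_g, r x_g, ..., r x_m.
   For the complete homogeneous symmetric polynomials h_k, the sum
     sum_g x_g h_k(p x_0, ..., p x_g, r x_g, ..., r x_m)
   telescopes after multiplication by p - r and equals [k+1]_{p,r} h_{k+1}(x),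
   with [k]_{p,r} = (p^k - r^k) / (p - r), while h_k(1, x) = sum_{j <= k} h_j(x).
   Hence the generating function of p^cr r^ne over T(M, l) is p^cr(M) r^ne(M)
   times a combination of the h_k(x) whose coefficients do not depend on M and
   are symmetric in p and r.  It is thus determined by the weight of M and the
   multiset of gap weights, that is, by the levels 0 and 1 of the tree.  The
   single statistics are the cases r = 1 and p = 1. *)

Set Implicit Arguments.
Unset Strict Implicit.
Unset Printing Implicit Defensive.

Import GRing.Theory Num.Theory.

(** * Complete homogeneous symmetric polynomials *)

Section CompleteHomogeneous.

Local Open Scope ring_scope.

Variable R : idomainType.
Implicit Types (p r x y : R) (s : seq R) (k l : nat).

(** The complete homogeneous symmetric polynomial h_k evaluated at a sequence, splitting monomials
    by whether they involve the first entry. Invariance under permutation is not built in; it is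
    [hsym_perm]. *)
Fixpoint hsym k : seq R -> R :=
  if k is k'.+1 then
    fix hsym_k s := if s is x :: s' then hsym_k s' + x * hsym k' s else 0
  else fun=> 1.

Lemma hsymS k x s : hsym k.+1 (x :: s) = hsym k.+1 s + x * hsym k (x :: s).
Proof. by []. Qed.

Lemma hsym_cons1 k s : hsym k (1 :: s) = \sum_(j < k.+1) hsym j s.
Proof.
elim: k => [|k IHk]; first by rewrite big_ord1.
by rewrite big_ord_recr hsymS IHk mul1r addrC.
Qed.

Lemma hsym_scale k p s : hsym k [seq p * x | x <- s] = p ^+ k * hsym k s.
Proof.
elim: k s => [|k IHk] s; first by rewrite mulr1.
elim: s => [|x s IHs]; first by rewrite mulr0.
rewrite map_cons !hsymS IHs -map_cons IHk exprS; ring.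
Qed.

(** This divided difference formula yields both the symmetry of h_k and the telescoping in
    [sum_hsym_split]. *)
Lemma hsym_cons_sub k x y s :
  hsym k.+1 (x :: s) - hsym k.+1 (y :: s) = (x - y) * hsym k (x :: y :: s).
Proof.
elim: k => [|k IHk]; first by rewrite !hsymS /=; ring.
rewrite (hsymS k.+1 x) (hsymS k.+1 y) (hsymS k x (y :: s)).
have -> : hsym k.+1 (x :: s) =
  hsym k.+1 (y :: s) + (x - y) * hsym k (x :: y :: s) by rewrite -IHk; ring.
ring.
Qed.

Lemma hsym_cat_sub k x y s1 s2 :
  hsym k.+1 (s1 ++ x :: s2) - hsym k.+1 (s1 ++ y :: s2) =
  (x - y) * hsym k (s1 ++ x :: y :: s2).
Proof.
elim: k s1 => [|k IHk]; elim=> [|z s1 IHs]; rewrite ?cat0s ?hsym_cons_sub //.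
  have := IHs; rewrite !cat_cons !hsymS /= => <-; ring.
rewrite !cat_cons (hsymS k z (s1 ++ [:: x, y & s2])) mulrDr -IHs.
by rewrite (mulrCA (x - y)) -(IHk (z :: s1)) !cat_cons !(hsymS k.+1 z); ring.
Qed.

Lemma hsym_cons_congr s t x :
  (forall k, hsym k s = hsym k t) -> forall k, hsym k (x :: s) = hsym k (x :: t).
Proof. by move=> eq_st; elim=> // k IHk; rewrite !hsymS IHk eq_st. Qed.

(** For x != y both sides are the same divided difference, so x - y can be cancelled in the
    domain. *)
Lemma hsym_swap k x y s : hsym k (x :: y :: s) = hsym k (y :: x :: s).
Proof.
have [-> // | neq_xy] := eqVneq x y.
have nz : x - y != 0 by rewrite subr_eq0.
apply: (mulfI nz); rewrite -hsym_cons_sub -(opprB y x) mulNr -hsym_cons_sub.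
by rewrite opprB.
Qed.

Lemma hsym_middle k x s t : hsym k (s ++ x :: t) = hsym k (x :: s ++ t).
Proof.
elim: s k => // y s IHs k.
by rewrite !cat_cons (hsym_cons_congr y IHs) hsym_swap.
Qed.

Lemma hsym_perm s t k : perm_eq s t -> hsym k s = hsym k t.
Proof.
elim: s t k => [|x s IHs] t k; first by rewrite perm_sym => /perm_nilP->.
move=> eq_xst; have xt : x \in t by rewrite -(perm_mem eq_xst) mem_head.
case/splitPr: xt eq_xst => t1 t2.
rewrite perm_sym -cat1s perm_catCA cat1s perm_cons perm_sym => eq_st.
by rewrite hsym_middle; apply: hsym_cons_congr => j; apply: IHs.
Qed.

Definition qnum p r k : R := \sum_(i < k) p ^+ (k.-1 - i) * r ^+ i.

Lemma qnumC p r k : qnum p r k = qnum r p k.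
Proof.
rewrite /qnum (reindex_inj rev_ord_inj); apply: eq_bigr => -[i lt_ik] _ /=.
rewrite mulrC; congr (_ ^+ _ * _ ^+ _); lia.
Qed.

(* The summands are divided differences of [hsym k.+1], so that, multiplied by
   [p - r], the sum telescopes. *)
Lemma sum_hsym_split p r k s : p != r ->
  \sum_(i < size s) s`_i *
    hsym k ([seq p * x | x <- take i.+1 s] ++ [seq r * x | x <- drop i s]) =
  qnum p r k.+1 * hsym k.+1 s.
Proof.
move=> neq_pr; have nz : p - r != 0 by rewrite subr_eq0.
apply: (mulfI nz); rewrite mulr_sumr mulrA /qnum -subrXX mulrBl -!hsym_scale.
(* [P i.+1] and [P i] differ only in entry i, scaled by p in one and by r in the other; the extreme
   values are h at p s and at r s. *)
pose P i := hsym k.+1 ([seq p * x | x <- take i s] ++ [seq r * x | x <- drop i s]).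
transitivity (\sum_(0 <= i < size s) (P i.+1 - P i)); last first.
  by rewrite telescope_sumr // /P take_size drop_size cats0 take0 drop0.
rewrite big_mkord; apply: eq_bigr => -[i lt_is] _ /=.
rewrite /P (take_nth 0) // (drop_nth 0 lt_is) !map_rcons !cat_rcons map_cons.
by rewrite hsym_cat_sub; ring.
Qed.

(* The sum over level l of the tree of the weights times h_k of the gap weights,
   when [h j] is that value for [h_j] at the root. *)
Fixpoint descend p r l k (h : nat -> R) : R :=
  if l is l'.+1 then
    \sum_(j < k.+1) qnum p r j.+1 * descend p r l' j.+1 h
  else h k.

(** This symmetry is what allows crossings on one side to be compared with nestings on the other. *)
Lemma descendC p r l k h : descend p r l k h = descend r p l k h.
Proof.
by elim: l k => //= l IHl k; apply: eq_bigr => j _; rewrite qnumC IHl.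
Qed.

Lemma eq_descend p r l k g h : g =1 h -> descend p r l k g = descend p r l k h.
Proof.
by move=> eq_gh; elim: l k => //= l IHl k; apply: eq_bigr => j _; rewrite IHl.
Qed.

End CompleteHomogeneous.

(** * Counting related pairs after adding one element *)

Section UnorderedPairs.

Variables (S U : finType) (f : S -> U) (e : U).
Variables (Q : rel S) (Q' : rel U) (M : {set S}).
Hypotheses (f_inj : injective f) (eNf : forall A, f A != e).
Hypotheses (QE : {in M &, forall A B, Q' (f A) (f B) = Q A B}).
Hypotheses (Q'C : symmetric Q') (Q'e : ~~ Q' e e).

(** A related pair is either the image of an old pair or contains [e]. As [e] is not in the image of
    [f], the cases are disjoint, and both parametrizations are injective. *)
Lemma card_pairs_setU1 :
  #|[set [set A; B] | A in e |: f @: M, B in e |: f @: M & Q' A B]| =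
  (#|[set [set A; B] | A in M, B in M & Q A B]| +
   #|[set A in M | Q' e (f A)]|)%N.
Proof.
set L := [set _ | _ in _, _ in _ & _].
set old := [set [set A; B] | A in M, B in M & Q A B].
set new := [set A in M | _].
have -> : L = [set f @: X | X : {set S} in old] :|: [set [set e; f A] | A in new].
  apply/setP=> X; apply/imset2P/setUP.
    case=> A B; rewrite !inE => /orP[/eqP-> | /imsetP[A0 A0M ->]].
      case/andP=> /orP[/eqP-> | /imsetP[B0 B0M ->]]; first by rewrite (negPf Q'e).
      by move=> QeB ->; right; apply/imsetP; exists B0; rewrite // inE B0M.
    case/andP=> /orP[/eqP-> | /imsetP[B0 B0M ->]].
      move=> QeA ->; right; apply/imsetP; exists A0; rewrite 1?setUC //.
      by rewrite inE A0M Q'C.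
    rewrite QE // => QAB ->; left; apply/imsetP; exists [set A0; B0].
      by apply/imset2P; exists A0 B0; rewrite ?inE ?B0M.
    by rewrite imsetU !imset_set1.
  case=> /imsetP[].
    move=> Y /imset2P[A B AM]; rewrite inE => /andP[BM QAB] -> ->.
    exists (f A) (f B); rewrite ?imsetU ?imset_set1 // !inE ?imset_f ?orbT //.
    by rewrite QE.
  move=> A; rewrite inE => /andP[AM QeA] ->.
  by exists e (f A); rewrite ?inE ?eqxx ?imset_f ?orbT.
rewrite cardsU (_ : _ :&: _ = set0) ?cards0 ?subn0; last first.
  apply/setP=> X; rewrite !inE; apply/negP=> /andP[/imsetP[Y _ ->]].
  case/imsetP=> A _ /setP/(_ e); rewrite !inE eqxx => /imsetP[B _ /eqP].
  by rewrite eq_sym (negPf (eNf B)).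
congr (_ + _)%N; first by rewrite card_imset //; apply: imset_inj.
apply: card_in_imset => A B _ _ /setP/(_ (f A)).
by rewrite !inE eqxx orbT (negPf (eNf A)) => /esym/eqP/f_inj.
Qed.

End UnorderedPairs.

(** * Insertion of a new first edge *)

Section InsertEdge.

Variable m : nat.
Implicit Types (A B : {set 'I_m}) (M : {set {set 'I_m}}) (y : 'I_m.+1).

Lemma emin_leq A i : i \in A -> emin A <= i.
Proof.
move=> iA; rewrite /emin; have := mem_index_enum i.
elim: (index_enum _) => // j r IHr; rewrite inE big_cons.
case/predU1P=> [<- | /IHr le_i]; first by rewrite iA geq_minl.
by case: ifP => // _; rewrite geq_min le_i orbT.
Qed.

Lemma emax_geq A i : i \in A -> i <= emax A.
Proof. exact: leq_bigmax_cond. Qed.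

Lemma eminE A i : i \in A -> {in A, forall j : 'I_m, i <= j} -> emin A = i.
Proof.
move=> iA min_i; apply/eqP; rewrite eqn_leq emin_leq //=.
rewrite /emin; elim/big_ind: _ => [|a b le_a le_b|j /min_i//]; last first.
  by rewrite leq_min le_a.
(* The empty case compares [i] with the default value [m], which exceeds every element of ['I_m]. *)
exact: ltnW.
Qed.

Lemma emaxE A i : i \in A -> {in A, forall j : 'I_m, j <= i} -> emax A = i.
Proof.
move=> iA max_i; apply/eqP; rewrite eqn_leq emax_geq // andbT.
exact/bigmax_leqP.
Qed.

Lemma edge_extremities A : emin A < emax A ->
  exists i j : 'I_m, [/\ i \in A, j \in A, {in A, forall k : 'I_m, i <= k},
                  {in A, forall k : 'I_m, k <= j} & emin A = i /\ emax A = j].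
Proof.
move=> ltA; have [i0 i0A] : exists i, i \in A.
  (* [emax] of the empty set is 0, which rules out the strict inequality. *)
  apply/set0Pn; apply: contraTneq ltA => ->.
  by rewrite -leqNgt /emax big_set0.
case: (arg_minnP (fun i : 'I_m => i : nat) i0A) => i iA min_i.
case: (arg_maxnP (fun i : 'I_m => i : nat) i0A) => j jA max_j.
by exists i, j; split=> //; split; [apply: eminE | apply: emaxE].
Qed.

Definition shift_edge y A : {set 'I_m.+2} := [set lift ord0 (lift y i) | i in A].

Definition first_edge y : {set 'I_m.+2} := [set ord0; lift ord0 y].

(** This is [child] for an arbitrary number [m] of vertices, and convertible to it when [m] is a
    double. *)
Definition insert M y : {set {set 'I_m.+2}} :=
  first_edge y |: [set shift_edge y A | A in M].

(** The property of matchings that the insertion lemmas rely on; it passes to children. *)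
Definition proper_edges M := {in M, forall A, emin A < emax A}.

Lemma shift_edge_inj y : injective (shift_edge y).
Proof. by apply: imset_inj => i j /lift_inj/lift_inj. Qed.

Lemma ord0_notin_shift y A : ord0 \notin shift_edge y A.
Proof. by apply/imsetP=> -[i _ /eqP]; rewrite (negPf (neq_lift _ _)). Qed.

Lemma shift_edge_neq_first y A : shift_edge y A != first_edge y.
Proof.
by apply: contraNneq (ord0_notin_shift y A) => ->; rewrite !inE eqxx.
Qed.

End InsertEdge.

Section InsertEdgeTheory.

Variable m : nat.
Implicit Types (A B : {set 'I_m}) (M : {set {set 'I_m}}) (y : 'I_m.+1).

Lemma emin_first y : emin (first_edge y) = 0.
Proof. by apply: (@eminE _ _ ord0); rewrite ?inE. Qed.

Lemma emax_first y : emax (first_edge y) = y.+1.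
Proof.
rewrite (@emaxE _ _ (lift ord0 y)) ?lift0 ?inE ?eqxx ?orbT // => j.
by rewrite !inE => /orP[] /eqP->.
Qed.

Lemma emin_emax_shift y A : emin A < emax A ->
  emin (shift_edge y A) = (bump y (emin A)).+1 /\
  emax (shift_edge y A) = (bump y (emax A)).+1.
Proof.
case/edge_extremities=> i [j [iA jA min_i max_j [-> ->]]]; split.
  rewrite (@eminE _ _ (lift ord0 (lift y i))) //; first exact: imset_f.
  move=> _ /imsetP[k kA ->].
  by have := min_i k kA; rewrite /= /bump; lia.
rewrite (@emaxE _ _ (lift ord0 (lift y j))) //; first exact: imset_f.
move=> _ /imsetP[k kA ->].
by have := max_j k kA; rewrite /= /bump; lia.
Qed.

Lemma proper_edges_insert M y : proper_edges M -> proper_edges (insert M y).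
Proof.
move=> prM A /setU1P[-> | /imsetP[B BM ->]]; first by rewrite emin_first emax_first.
have ltB := prM B BM; have [-> ->] := emin_emax_shift y ltB.
by move: ltB; rewrite /bump; lia.
Qed.

(** A new first edge whose second end lies just before vertex [g] crosses exactly the edges counted
    here, and nests exactly those counted by [closing]. *)
Definition covering M (g : nat) := #|[set A in M | emin A < g <= emax A]|.

Definition closing M (g : nat) := #|[set A in M | emax A < g]|.

Lemma crossingC : symmetric (@crossing m).
Proof. by move=> A B; apply: orbC. Qed.

Lemma nestedC : symmetric (@nested m).
Proof. by move=> A B; apply: orbC. Qed.

End InsertEdgeTheory.

(** * Effect of an insertion on the statistics and on the gaps *)

Section InsertEdgeStatistics.

Variables (m : nat) (M : {set {set 'I_m}}) (y : 'I_m.+1).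
Hypothesis prM : proper_edges M.

Lemma cr_insert : cr (insert M y) = cr M + covering M y.
Proof.
rewrite /cr (@card_pairs_setU1 _ _ (shift_edge y) _ (@crossing m)).
- congr (_ + _); apply: eq_card => A; rewrite !inE.
  case AM: (A \in M) => //=; have ltA := prM AM.
  have [eA1 eA2] := emin_emax_shift y ltA.
  rewrite /crossing emin_first emax_first eA1 eA2 /bump; lia.
- exact: shift_edge_inj.
- exact: shift_edge_neq_first.
- move=> A B AM BM; have [eA1 eA2] := emin_emax_shift y (prM AM).
  have [eB1 eB2] := emin_emax_shift y (prM BM).
  rewrite /crossing eA1 eA2 eB1 eB2 /bump; lia.
- exact: crossingC.
- by rewrite /crossing !ltnn.
Qed.

Lemma ne_insert : ne (insert M y) = ne M + closing M y.
Proof.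
rewrite /ne (@card_pairs_setU1 _ _ (shift_edge y) _ (@nested m)).
- congr (_ + _); apply: eq_card => A; rewrite !inE.
  case AM: (A \in M) => //=; have ltA := prM AM.
  have [eA1 eA2] := emin_emax_shift y ltA.
  rewrite /nested emin_first emax_first eA1 eA2 /bump; lia.
- exact: shift_edge_inj.
- exact: shift_edge_neq_first.
- move=> A B AM BM; have [eA1 eA2] := emin_emax_shift y (prM AM).
  have [eB1 eB2] := emin_emax_shift y (prM BM).
  rewrite /nested eA1 eA2 eB1 eB2 /bump; lia.
- exact: nestedC.
- by rewrite /nested !ltnn.
Qed.

Lemma card_insert (P : pred {set 'I_m.+2}) :
  #|[set A in insert M y | P A]| =
  P (first_edge y) + #|[set A in M | P (shift_edge y A)]|.
Proof.
rewrite -(card_imset _ (@shift_edge_inj _ y)).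
have <- : [set A in shift_edge y @: M | P A] =
          shift_edge y @: [set A in M | P (shift_edge y A)].
  apply/setP=> A; rewrite inE; apply/andP/imsetP => [[/imsetP[B BM ->] PB]|[B]].
    by exists B; rewrite // inE BM.
  by rewrite inE => /andP[BM PB] ->; rewrite imset_f.
rewrite /insert; have fN : first_edge y \notin shift_edge y @: M.
  by apply/imsetP=> -[A _ /esym/eqP]; rewrite (negPf (shift_edge_neq_first _ _)).
case Pf: (P _); last first.
  rewrite add0n; apply: eq_card => A; rewrite !inE.
  by have [-> | //] := eqVneq A (first_edge y); rewrite Pf !andbF.
transitivity #|first_edge y |: [set A in shift_edge y @: M | P A]|.
  apply: eq_card => A; rewrite !inE.
  by have [-> | //] := eqVneq A (first_edge y).
by rewrite cardsU1 !inE (negPf fN).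
Qed.

Lemma covering_insert0 : covering (insert M y) 0 = 0.
Proof. by apply: eq_card0 => A; rewrite !inE andbF. Qed.

Lemma closing_insert0 : closing (insert M y) 0 = 0.
Proof. by apply: eq_card0 => A; rewrite !inE andbF. Qed.

(** The new end splits gap [y] into the gaps [y.+1] and [y.+2]. Gaps up to [y] move by one and
    become covered by the new edge; gaps from [y] on move by two and lie after its end. Hence [y]
    occurs in both families of lemmas. *)
Lemma covering_insert_le g : g <= y ->
  covering (insert M y) g.+1 = (covering M g).+1.
Proof.
move=> le_gy; rewrite /covering card_insert emin_first emax_first.
have -> : 0 < g.+1 <= y.+1 by lia.
congr _.+1; apply: eq_card => A; rewrite !inE; case AM: (A \in M) => //=.
have [-> ->] := emin_emax_shift y (prM AM); rewrite /bump; lia.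
Qed.

Lemma closing_insert_le g : g <= y -> closing (insert M y) g.+1 = closing M g.
Proof.
move=> le_gy; rewrite /closing card_insert emax_first.
have -> : (y.+1 < g.+1) = false by lia.
apply: eq_card => A; rewrite !inE; case AM: (A \in M) => //=.
have [_ ->] := emin_emax_shift y (prM AM); rewrite /bump; lia.
Qed.

Lemma covering_insert_ge g : y <= g ->
  covering (insert M y) g.+2 = covering M g.
Proof.
move=> le_yg; rewrite /covering card_insert emin_first emax_first.
have -> : 0 < g.+2 <= y.+1 = false by lia.
apply: eq_card => A; rewrite !inE; case AM: (A \in M) => //=.
have [-> ->] := emin_emax_shift y (prM AM); rewrite /bump; lia.
Qed.

Lemma closing_insert_ge g : y <= g ->
  closing (insert M y) g.+2 = (closing M g).+1.
Proof.
move=> le_yg; rewrite /closing card_insert emax_first.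
have -> : y.+1 < g.+2 by lia.
congr _.+1; apply: eq_card => A; rewrite !inE; case AM: (A \in M) => //=.
have [_ ->] := emin_emax_shift y (prM AM); rewrite /bump; lia.
Qed.

End InsertEdgeStatistics.

(** The new edge is recognized as the one containing [ord0], and removing it gives back the parent.
    So no matching arises twice within a level of the tree. *)
Lemma insert_inj m (M M' : {set {set 'I_m}}) (y y' : 'I_m.+1) :
  insert M y = insert M' y' -> M = M' /\ y = y'.
Proof.
move=> eqI; have eqy : y = y'.
  have: first_edge y \in insert M' y' by rewrite -eqI setU11.
  case/setU1P=> [/setP/(_ (lift ord0 y)) | /imsetP[A _ eqA]].
    rewrite !inE eqxx orbT => /esym/orP[/eqP/(congr1 val) // | /eqP].
    exact: lift_inj.
  by have := ord0_notin_shift y' A; rewrite -eqA !inE eqxx.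
move: eqI; rewrite -eqy => /(congr1 (fun Z => Z :\ first_edge y)).
rewrite /insert !setU1K; first by move/(imset_inj (@shift_edge_inj _ y)).
all: by apply/imsetP=> -[A _ /esym/eqP]; rewrite (negPf (shift_edge_neq_first _ _)).
Qed.

(** * Weighted sums over the levels of the tree *)

Section WeightedCount.

Local Open Scope ring_scope.

Variable R : idomainType.
Implicit Types (p r : R) (k l m n : nat).

Definition weight p r m (M : {set {set 'I_m}}) : R := p ^+ cr M * r ^+ ne M.

(* The gap g lies just before the vertex g, so there are m.+1 of them. *)
Definition gap_weights p r m (M : {set {set 'I_m}}) : seq R :=
  [seq p ^+ covering M g * r ^+ closing M g | g <- iota 0 m.+1].

Lemma size_gap_weights p r m (M : {set {set 'I_m}}) :
  size (gap_weights p r M) = m.+1.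
Proof. by rewrite size_map size_iota. Qed.

Lemma weight_insert p r m (M : {set {set 'I_m}}) (y : 'I_m.+1) :
  proper_edges M ->
  weight p r (insert M y) = weight p r M * (gap_weights p r M)`_y.
Proof.
move=> prM; rewrite /weight cr_insert // ne_insert // !exprD mulrACA.
by rewrite (nth_map 0) ?size_iota // nth_iota.
Qed.

Lemma gap_weights_insert p r m (M : {set {set 'I_m}}) (y : 'I_m.+1) :
  proper_edges M ->
  gap_weights p r (insert M y) =
  1 :: [seq p * x | x <- take y.+1 (gap_weights p r M)]
       ++ [seq r * x | x <- drop y (gap_weights p r M)].
Proof.
move=> prM; have le_ym : (y <= m)%N by rewrite -ltnS.
rewrite /gap_weights -!map_take -!map_drop take_iota drop_iota add0n -!map_comp.
have -> : iota 0 m.+3 =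
    0%N :: [seq g.+1 | g <- iota 0 y.+1] ++ [seq g.+2 | g <- iota y (m.+1 - y)].
  rewrite -(iotaDl 1 0) -(iotaDl 2 y) -[(2 + y)%N]/(1 + y.+1)%N -iotaD.
  by rewrite -[LHS]/(0%N :: iota 1 m.+2); congr (_ :: iota _ _); lia.
rewrite map_cons covering_insert0 closing_insert0 mulr1 map_cat -!map_comp.
congr (_ :: _ ++ _).
  rewrite (minn_idPl _) ?ltnS //; apply/eq_in_map => g; rewrite mem_iota /= => lt_g.
  by rewrite covering_insert_le // closing_insert_le // exprS mulrA.
apply/eq_in_map => g; rewrite mem_iota /= => /andP[le_yg _].
by rewrite covering_insert_ge // closing_insert_ge // exprS mulrCA.
Qed.

Lemma sum_hsym_insert p r k m (M : {set {set 'I_m}}) :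
  p != r -> proper_edges M ->
  \sum_(y < m.+1) weight p r (insert M y) * hsym k (gap_weights p r (insert M y)) =
  \sum_(j < k.+1) qnum p r j.+1 * (weight p r M * hsym j.+1 (gap_weights p r M)).
Proof.
move=> neq_pr prM; set x := gap_weights p r M.
transitivity (\sum_(j < k.+1) \sum_(y < m.+1) weight p r M * (x`_y *
    hsym j ([seq p * z | z <- take y.+1 x] ++ [seq r * z | z <- drop y x]))).
  rewrite exchange_big; apply: eq_bigr => y _.
  by rewrite weight_insert // gap_weights_insert // hsym_cons1 -!mulr_sumr mulrA.
apply: eq_bigr => j _; rewrite -mulr_sumr mulrCA -sum_hsym_split //.
by rewrite size_gap_weights.
Qed.

Lemma childE n (M : {set {set 'I_n.*2}}) y : child M y = insert M y.
Proof. by []. Qed.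

Lemma proper_edges_T n (M : {set {set 'I_n.*2}}) l P :
  proper_edges M -> P \in T M l -> proper_edges P.
Proof.
move=> prM; elim: l P => [|l IHl] P; first by move/set1P->.
case/bigcupP=> Q QT /imsetP[y _ ->]; rewrite childE.
exact/proper_edges_insert/IHl.
Qed.

Lemma big_T_S n (M : {set {set 'I_n.*2}}) l (E : _ -> R) :
  \sum_(P in T M l.+1) E P = \sum_(P in T M l) \sum_y E (insert P y).
Proof.
rewrite /= pair_big_dep /=.
(* The level is an injective image of pairs (parent, gap); the predicate has the shape left by
   [pair_big_dep]. *)
have -> : \bigcup_(P in T M l) children P =
    [set insert z.1 z.2 | z in [pred z | (z.1 \in T M l) && true]].
  apply/setP=> P; apply/bigcupP/imsetP=> [[Q QT /imsetP[y _ ->]]|[[Q y]]].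
    by exists (Q, y); rewrite // !inE QT.
  by rewrite !inE andbT => QT ->; exists Q => //; apply/imsetP; exists y.
by rewrite big_imset // => -[P y] [Q z] _ _ /insert_inj[/= -> ->].
Qed.

(** The induction on [l] keeps [k] general, because one level turns h_k into a combination of h_1,
    ..., h_{k+1}. *)
Lemma sum_T_hsym p r n (M : {set {set 'I_n.*2}}) l k :
  p != r -> proper_edges M ->
  \sum_(P in T M l) weight p r P * hsym k (gap_weights p r P) =
  descend p r l k (fun j => weight p r M * hsym j (gap_weights p r M)).
Proof.
move=> neq_pr prM; elim: l k => [|l IHl] k; first by rewrite big_set1.
rewrite big_T_S; under eq_bigr => P PT.
  rewrite sum_hsym_insert //; last exact: proper_edges_T PT.
over.
by rewrite exchange_big; apply: eq_bigr => j _; rewrite -mulr_sumr IHl.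
Qed.

Lemma sum_T_weight p r n (M : {set {set 'I_n.*2}}) l :
  p != r -> proper_edges M ->
  \sum_(P in T M l) weight p r P =
  descend p r l 0 (fun j => weight p r M * hsym j (gap_weights p r M)).
Proof.
by move=> neq_pr prM; rewrite -sum_T_hsym //; apply: eq_bigr => P; rewrite mulr1.
Qed.

Lemma values_T1 (X : eqType) n (M : {set {set 'I_n.*2}})
    (f : {set {set 'I_n.+1.*2}} -> X) :
  perm_eq (values f (T M 1)) [seq f (insert M y) | y : 'I_n.*2.+1].
Proof.
rewrite /values /= big_set1 [X in perm_eq _ X](map_comp f (insert M)) perm_map //.
apply: uniq_perm; rewrite ?enum_uniq //.
  by rewrite map_inj_uniq ?enum_uniq // => y z /insert_inj[].
move=> P; rewrite mem_enum; apply/imsetP/mapP=> -[y yE ->]; exists y => //.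
by rewrite mem_enum.
Qed.

Lemma values_weight_T1 p r n (M : {set {set 'I_n.*2}}) : proper_edges M ->
  perm_eq (values (weight p r (m := (1 + n).*2)) (T M 1))
          [seq weight p r M * x | x <- gap_weights p r M].
Proof.
move=> prM; apply: perm_trans (values_T1 _ _) _.
rewrite /image_mem (eq_map (fun y => weight_insert p r y prM)).
rewrite (map_comp (fun x => weight p r M * x)) perm_map //.
rewrite (map_comp (nth 0 (gap_weights p r M))) val_enum_ord.
by rewrite -{1}(size_gap_weights p r M) map_nth_iota0 ?take_size.
Qed.

(** Swapped parameters encode the comparison of [cr] with [ne], or of [cn] with [nc]. *)
Definition same_params p r p' r' := p' = p /\ r' = r \/ p' = r /\ r' = p.

Lemma sum_T_weight_eq p r p' r' n (M N : {set {set 'I_n.*2}}) :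
    p != 0 -> r != 0 -> p != r -> same_params p r p' r' ->
    proper_edges M -> proper_edges N ->
    weight p r M = weight p' r' N ->
    perm_eq (values (weight p r (m := (1 + n).*2)) (T M 1))
            (values (weight p' r' (m := (1 + n).*2)) (T N 1)) ->
  forall l, \sum_(P in T M l) weight p r P = \sum_(P in T N l) weight p' r' P.
Proof.
move=> p0 r0 neq_pr par prM prN eqW eqW1 l.
have neq_pr' : p' != r' by case: par => -[-> ->]; rewrite // eq_sym.
have -> : \sum_(P in T N l) weight p' r' P =
    descend p r l 0 (fun j => weight p' r' N * hsym j (gap_weights p' r' N)).
  by rewrite sum_T_weight //; case: par => -[-> ->]; rewrite // descendC.
rewrite sum_T_weight //; apply: eq_descend => j; rewrite -eqW; congr (_ * _).
(* The common root weight is nonzero because p and r are, so it cancels from the level 1 multisets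
   and leaves the gap weights. *)
apply: hsym_perm; have W0 : weight p r M != 0 by rewrite mulf_neq0 ?expf_neq0.
apply: (perm_map_inj (mulfI W0)); rewrite perm_sym {1}eqW.
have := values_weight_T1 p' r' prN; rewrite perm_sym => /perm_trans-> //.
by rewrite perm_sym in eqW1; apply: perm_trans eqW1 (values_weight_T1 _ _ prM).
Qed.
End WeightedCount.

(** * Recovering a multiset from its generating polynomial *)

Section Decoding.

Local Open Scope ring_scope.

Lemma coef_sum_polyXn (s : seq nat) a :
  (\sum_(i <- s) 'X^i : {poly int})`_a = (count_mem a s)%:R.
Proof.
rewrite coef_sum -sum1_count natr_sum [RHS]big_mkcond; apply: eq_bigr => i _.
by rewrite coefXn eq_sym /=; case: (i == a).
Qed.

(** Coefficients are multiplicities, and these are faithfully represented in the integers. *)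
Lemma perm_eq_sum_polyXn (s t : seq nat) :
  \sum_(i <- s) 'X^i = \sum_(i <- t) 'X^i :> {poly int} -> perm_eq s t.
Proof.
move=> eq_st; apply/allP=> a _ /=; rewrite -(eqr_nat int) -!coef_sum_polyXn.
by rewrite eq_st.
Qed.

(** The inner variable marks the first component, the outer variable the second. *)
Definition monomial2 (z : nat * nat) : {poly {poly int}} :=
  'X%:P ^+ z.1 * 'X ^+ z.2.

Lemma coef_sum_monomial2 (s : seq (nat * nat)) z :
  (\sum_(i <- s) monomial2 i)`_z.2`_z.1 = (count_mem z s)%:R.
Proof.
rewrite !coef_sum -sum1_count natr_sum [RHS]big_mkcond; apply: eq_bigr => i _.
case: z i => a b [c d]; rewrite /monomial2 /= -rmorphXn coefCM coefXn xpair_eqE.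
rewrite (eq_sym c) (eq_sym d); case: eqP => _; last by rewrite mulr0 coef0 andbF.
by rewrite mulr1 coefXn andbT; case: (a == c).
Qed.

Lemma perm_eq_sum_monomial2 (s t : seq (nat * nat)) :
  \sum_(i <- s) monomial2 i = \sum_(i <- t) monomial2 i -> perm_eq s t.
Proof.
move=> eq_st; apply/allP=> z _ /=; rewrite -(eqr_nat int) -!coef_sum_monomial2.
by rewrite eq_st.
Qed.

End Decoding.

Lemma proper_edges_matching n (M : {set {set 'I_n.*2}}) :
  M \in matchings n -> proper_edges M.
Proof.
rewrite inE => /andP[_ /forall_inP card2] A /card2/cards2P[i [j [neq_ij eqA]]].
have iA : i \in A by rewrite eqA !inE eqxx.
have jA : j \in A by rewrite eqA !inE eqxx orbT.
move: neq_ij (emin_leq iA) (emin_leq jA) (emax_geq iA) (emax_geq jA).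
by rewrite -val_eqE /=; lia.
Qed.

(** * From weighted sums back to the statistics *)

Section Statistics.

Local Open Scope ring_scope.

(** Common to single and joint statistics: [e] turns a value into its monomial, and the first
    hypothesis decodes a sum of monomials. *)
Lemma perm_values_T (R : idomainType) (X : eqType) (e : X -> R) (p r p' r' : R)
    (f g : forall m : nat, {set {set 'I_m}} -> X)
    n (M N : {set {set 'I_n.*2}}) :
    (forall s t, \sum_(i <- s) e i = \sum_(i <- t) e i -> perm_eq s t) ->
    (forall m (P : {set {set 'I_m}}), e (f m P) = weight p r P) ->
    (forall m (P : {set {set 'I_m}}), e (g m P) = weight p' r' P) ->
    p != 0 -> r != 0 -> p != r -> same_params p r p' r' ->
    M \in matchings n -> N \in matchings n ->
    (forall l, (l <= 1)%N -> perm_eq (values (f (l + n).*2) (T M l))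
                                     (values (g (l + n).*2) (T N l))) ->
  forall l, perm_eq (values (f (l + n).*2) (T M l))
                    (values (g (l + n).*2) (T N l)).
Proof.
move=> e_inj fE gE p0 r0 neq_pr par /proper_edges_matching prM.
move=> /proper_edges_matching prN eq01 l; apply: e_inj; rewrite !big_image.
under eq_bigr do rewrite fE; under [RHS]eq_bigr do rewrite gE.
apply: sum_T_weight_eq => //.
  (* Level 0 is a singleton, so its multiset yields equality of the root weights. *)
  have := eq01 0%N isT; rewrite /values /image_mem !enum_set1 => /perm_mem eqMN.
  have := eqMN (f _ M); rewrite !inE eqxx => /esym/eqP eqfg.
  by rewrite -fE -gE eqfg.
have /(perm_map e) := eq01 1%N isT; rewrite /values /image_mem -!map_comp.
by rewrite (eq_map (fE _)) (eq_map (gE _)).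
Qed.

End Statistics.

Theorem theorem1p2 (n : nat) (M N : {set {set 'I_n.*2}})
    (hM : M \in matchings n) (hN : N \in matchings n)
    (s t : forall m : nat, {set {set 'I_m}} -> nat)
    (hs : s = cr \/ s = ne) (ht : t = cr \/ t = ne)
    (u v : forall m : nat, {set {set 'I_m}} -> nat * nat)
    (hu : u = cn \/ u = nc) (hv : v = cn \/ v = nc) :
  ((forall l : nat, l <= 1 ->
      perm_eq (values (s (l + n).*2) (T M l)) (values (t (l + n).*2) (T N l))) ->
   forall l : nat,
      perm_eq (values (s (l + n).*2) (T M l)) (values (t (l + n).*2) (T N l)))
  /\
  ((forall l : nat, l <= 1 ->
      perm_eq (values (u (l + n).*2) (T M l)) (values (v (l + n).*2) (T N l))) ->
   forall l : nat,
      perm_eq (values (u (l + n).*2) (T M l)) (values (v (l + n).*2) (T N l))).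
Proof.
split.
  pose X : {poly int} := 'X%R.
  have X0 : X != 0%R by rewrite polyX_eq0.
  have X1 : X != 1%R.
    by apply/eqP=> /polyP/(_ 1); rewrite coefX coefC.
  have crE m (P : {set {set 'I_m}}) : ('X^(cr P) = weight X 1 P)%R.
    by rewrite /weight expr1n mulr1.
  have neE m (P : {set {set 'I_m}}) : ('X^(ne P) = weight 1 X P)%R.
    by rewrite /weight expr1n mul1r.
  (* Equal statistics use equal parameters and different ones swapped parameters; [eq_sym] serves
     the cases where the parameters of [M] are 1 and X in this order. *)
  case: hs ht => -> [] ->; apply: (perm_values_T perm_eq_sum_polyXn);
    (try exact: crE); (try exact: neE); rewrite ?oner_neq0 //;
    first [by left | by right | by rewrite eq_sym].
pose X : {poly {poly int}} := ('X%:P)%R; pose Y : {poly {poly int}} := 'X%R.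
have X0 : X != 0%R by rewrite polyC_eq0 polyX_eq0.
have Y0 : Y != 0%R by rewrite polyX_eq0.
have XY : X != Y.
  by apply/eqP=> /polyP/(_ 1)/eqP; rewrite coefX coefC /= eq_sym oner_eq0.
have cnE m (P : {set {set 'I_m}}) : monomial2 (cn P) = weight X Y P by [].
have ncE m (P : {set {set 'I_m}}) : monomial2 (nc P) = weight Y X P.
  by rewrite /monomial2 mulrC.
case: hu hv => -> [] ->; apply: (perm_values_T perm_eq_sum_monomial2);
  (try exact: cnE); (try exact: ncE); rewrite //;
  first [by left | by right | by rewrite eq_sym].
Qed.
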